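(* Let $S$ be a zero-divisor semigroup with zero-divisor graph $G=\Gamma(S)$. Assume that for a vertex $x$ of $G$ (i.e. a nonzero element $x$ of $S$) there exists a subset $T_x$ of $S\setminus\{0,x\}$ satisfying the following conditions: (1) $T_x$ contains all end vertices of $G$ adjacent to $x$; (2) there is no edge of $G$ linking a vertex in $T_x$ with a vertex in $S\setminus(T_x\cup\{0,x\})$ when $S\setminus(T_x\cup\{0,x\})\neq\emptyset$; (3) either $S\setminus(T_x\cup\{0,x\})\neq\emptyset$, or $G$ has a cycle and $x$ is adjacent to at least one end vertex of $G$. Then $T=S\setminus T_x$ is a sub-semigroup of $S$.
   Context: All semigroups are commutative, written multiplicatively, and have a zero element $0$ with $0x=0$ for all $x$. A zero-divisor semigroup is such a semigroup $S$ in which every element is a zero-divisor (an element $x$ with $xy=0$ for some nonzero $y\in S$). The zero-divisor graph $\Gamma(S)$ is the undirected simple graph whose vertices are the nonzero zero-divisors of $S$ (here: all of $S\setminus\{0\}$), with distinct vertices $x,y$ adjacent if and only if $xy=0$. An end vertex is a vertex of degree one. *)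

(* Defs.v *)
From mathcomp Require Import all_boot.
From mathcomp Require Import boolp classical_sets functions cardinality.

Set Implicit Arguments.
Unset Strict Implicit.
Unset Printing Implicit Defensive.

Import Algebra.

Local Open Scope group_scope.
Local Open Scope classical_set_scope.
Local Open Scope card_scope.

Section ZeroDivisorGraph.
Variables (S : semigroupType) (z : S).
Implicit Types (u v x y : S) (A : set S).

(* The witness y may be equal to x. *)
Definition zero_divisor x := exists2 y, y != z & x * y = z.

Record zero_divisor_semigroup : Prop := ZeroDivisorSemigroup {
  zds_mulC : commutative (@mul S);
  zds_mul0 : left_zero z (@mul S);
  zds_zero_divisor : forall x, zero_divisor x
}.

(* Every element of a zero-divisor semigroup is a zero-divisor, so the vertices
   of its zero-divisor graph are exactly the elements other than z. *)
Definition vertices : set S := [set x | x != z].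

Definition adjacent : rel S :=
  [rel u v | [&& u != z, v != z, u != v & u * v == z]].

Definition neighbours v : set S := [set u | adjacent v u].

Definition end_vertex v := vertices v /\ neighbours v #= `I_1.

Definition has_cycle := exists2 c : seq S, 2 < size c & ucycle adjacent c.

Definition subsemigroup A := A !=set0 /\ mulg_closed (mem A).

End ZeroDivisorGraph.

(* Main.v *)
Require Import Defs.
From mathcomp Require Import all_boot.
From mathcomp Require Import boolp classical_sets functions cardinality.

(** Annihilators propagate along products: if [u * w] is zero, so is
    [(u * c) * w].  Hence each neighbour of a vertex [u] is a neighbour of every
    nonzero multiple [u * c] other than itself.  The set [Tx] meets the rest of
    the graph only through the cut vertex [x], so a product landing in [Tx]
    drags neighbours of its factors into [Tx ∪ {x}].

    Suppose first that some vertex lies outside [Tx ∪ {x}].  Such a vertex [b]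
    is not an end vertex attached to [x], so it has a neighbour [w] other than
    [x], also outside [Tx].  A product [b * c] in [Tx] would be adjacent to [w],
    which is impossible ([cut_mul_notin]).  The remaining product [x * x] is
    handled by [cut_square_notin]: were it in [Tx], all nonzero annihilators of
    [x] would be in [Tx].  Multiplying one of them by an annihilator of a vertex
    outside [Tx ∪ {x}], as in the proof that zero-divisor graphs have diameter
    at most three, joins [Tx] to the outside without passing through [x].

    If every vertex lies in [Tx ∪ {x}], only [x * x] matters.  It annihilates
    every end vertex [v] attached to [x], so it is zero, [x] or [v].  The last
    case would force [x * a = x] for both ends [a] of every edge avoiding [x],
    hence [x = x * a * b] would be zero; but a cycle has an edge avoiding [x]
    ([pendant_square_neq]). *)

Local Open Scope classical_set_scope.

Section ZeroDivisorSemigroup.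
Set Implicit Arguments.
Unset Strict Implicit.
Local Open Scope group_scope.
Local Open Scope card_scope.
Variables (S : semigroupType) (z : S).
Hypothesis hS : zero_divisor_semigroup z.
Implicit Types (a b c u v w x y : S) (A : set S).

Let mulC : commutative (@mul S) := zds_mulC hS.
Let mul0g : left_zero z (@mul S) := zds_mul0 hS.
Let mulg0 u : u * z = z.
Proof. by rewrite mulC mul0g. Qed.

(** * Neighbours and end vertices *)

Lemma adjacentP u v :
  reflect [/\ u != z, v != z, u != v & u * v = z] (adjacent z u v).
Proof. by apply: (iffP and4P) => -[? ? ? /eqP]. Qed.

Lemma adjacent_sym : symmetric (adjacent z).
Proof.
by move=> u v; apply/adjacentP/adjacentP => -[nu nv nuv uv0]; split;
  rewrite // 1?eq_sym // mulC.
Qed.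

Lemma end_vertex_unique_neighbour v x : adjacent z v x ->
  end_vertex z v <-> (forall u, adjacent z v u -> u = x).
Proof.
move=> vx; split=> [[_ /eq_cardSP[y _]] | only_x].
  rewrite II0 card_eq0 => /eqP no_more u vu.
  have eq_y w : adjacent z v w -> w = y.
    move=> vw; apply: contrapT => nwy.
    by have : set0 w by rewrite -no_more.
  by rewrite (eq_y u) // (eq_y x).
split; first by case/adjacentP: vx.
suff -> : neighbours z v = [set x] by exact: card_set1.
by apply/seteqP; split=> [u /only_x | u ->].
Qed.

(** An annihilator of [u] may be [u] itself, so the existence of a neighbour has
    content only when [u] is its sole annihilator at hand; then another vertex
    [w] supplies [u * w], or an annihilator of [w]. *)
Lemma exists_neighbour u w : u != z -> w != z -> u != w ->
  exists v, adjacent z u v.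
Proof.
move=> nu nw nuw.
have [y ny uy0] := zds_zero_divisor hS u.
have [eyu|nyu] := eqVneq y u; last first.
  by exists y; apply/adjacentP; split; rewrite // eq_sym.
rewrite {}eyu {ny} in uy0.
have [uw0|nuw0] := eqVneq (u * w) z; first by exists w; apply/adjacentP.
have [euw|nuwu] := eqVneq (u * w) u; last first.
  by exists (u * w); apply/adjacentP; split; rewrite // 1?eq_sym // mulgA uy0.
have [v nv wv0] := zds_zero_divisor hS w.
exists v; apply/adjacentP; split=> //.
  by apply: contraNneq nuw0 => ->; rewrite mulC wv0.
by rewrite -euw -mulgA wv0 mulg0.
Qed.

(** * Products across a cut vertex *)

Section CutVertex.
Variables (x : S) (A : set S).
Hypotheses (Az : ~ A z) (Ax : ~ A x).
Hypothesis A_cut : forall u v, A u -> adjacent z u v -> v != x -> A v.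

Lemma cut_annihilator_in u v : A u -> v != z -> v != x -> u * v = z -> A v.
Proof.
move=> Au nv nvx uv0; have [<-//|nuv] := eqVneq u v.
apply: (A_cut Au _ nvx); apply/adjacentP; split=> //.
by apply/eqP => uz; rewrite uz in Au.
Qed.

(** A neighbour [w] of [b] annihilates [b * c].  From a product in [A], the cut
    condition therefore pulls [w] and then [b] into [A]. *)
Lemma cut_mul_notin b c w :
  ~ A b -> b != x -> adjacent z b w -> w != x -> ~ A (b * c).
Proof.
move=> Ab nbx /adjacentP[nb nw _ bw0] nwx Abc.
have Aw : A w.
  by apply: (cut_annihilator_in Abc) => //; rewrite mulC mulgA (mulC w) bw0 mul0g.
by apply: Ab; apply: (cut_annihilator_in Aw) => //; rewrite mulC.
Qed.

(** If [x * x] is in [A], then so is every nonzero annihilator [u] of [x].  For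
    [w] outside [A] with annihilator [y], the product [u * y] links the two
    sides: it is zero, or else an annihilator of both [x] and [w]. *)
Lemma cut_square_notin w : w != z -> w != x -> ~ A w -> ~ A (x * x).
Proof.
move=> nw nwx Aw Axx.
have annx u : u != z -> u * x = z -> A u.
  move=> nu ux0; apply: (cut_annihilator_in Axx) => //.
    by apply: contra_not_neq Az => ux; rewrite -ux0 {1}ux.
  by rewrite mulC mulgA ux0 mul0g.
have [u nu xu0] := zds_zero_divisor hS x.
have Au : A u by apply: annx => //; rewrite mulC.
have [y ny wy0] := zds_zero_divisor hS w.
have yw0 : y * w = z by rewrite mulC.
have nyx : y != x by apply: contra_not_neq Aw => yx; apply: annx; rewrite // -yx.
have Ay : ~ A y by move=> /cut_annihilator_in/(_ nw nwx yw0).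
have [uy0|nuy] := eqVneq (u * y) z.
  by apply: Ay; apply: (cut_annihilator_in Au).
have Auy : A (u * y) by apply: annx; rewrite // mulC mulgA xu0 mul0g.
by apply: Aw; apply: (cut_annihilator_in Auy); rewrite // -mulgA yw0 mulg0.
Qed.

End CutVertex.

(** * The square of a vertex attached to an end vertex *)

Lemma pendant_annihilator v x u : end_vertex z v -> adjacent z v x ->
  u != z -> v * u = z -> u = v \/ u = x.
Proof.
move=> ev vx nu vu0; have [->|nuv] := eqVneq u v; [by left | right].
apply: (proj1 (end_vertex_unique_neighbour vx) ev); apply/adjacentP.
by case/adjacentP: vx => nv _ _ _; split; rewrite // eq_sym.
Qed.

Lemma cycle_edge_avoiding x : has_cycle z ->
  exists a b, [/\ adjacent z a b, a != x & b != x].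
Proof.
move=> [[|a [|b [|c s]]] // _ /andP[cyc un]].
have /and3P[ab bc cs] :
  [&& adjacent z a b, adjacent z b c & path (adjacent z) c (rcons s a)] := cyc.
move: un cs; rewrite !cons_uniq !inE rcons_path => /and3P[na nb _] /andP[_ la].
have [/norP[nab nas] /norP[nbc nbs]] := (na, nb).
have [ax|nax] := eqVneq a x.
  exists b, c; split=> //; rewrite -ax; first by rewrite eq_sym.
  by case/norP: nas; rewrite eq_sym.
have [bx|nbx] := eqVneq b x; last by exists a, b.
exists (last c s), a; split=> //; rewrite -bx.
apply: contraTneq (mem_last c s) => ->.
by rewrite inE negb_or nbc.
Qed.

(** With [x * x = v], every [a] other than zero, [x] and [v] satisfies
    [v * (x * a) = z] and [v * a != z], which leaves only [x * a = x]. *)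
Lemma pendant_square_neq v x : end_vertex z v -> adjacent z v x ->
  has_cycle z -> x * x != v.
Proof.
move=> ev vx /(cycle_edge_avoiding x)[a [b [ab nax nbx]]].
apply/eqP => xxv.
have [nv nx nvx vx0] := adjacentP _ _ vx.
have only_x := proj1 (end_vertex_unique_neighbour vx) ev.
have fix_x c d : adjacent z c d -> c != x -> d != x -> x * c = x.
  move=> cd ncx ndx.
  have ncv : c != v by apply: contraNneq ndx => cv; rewrite (only_x d) -?cv.
  have nc : c != z by case/adjacentP: cd.
  have nvc : v * c != z.
    by apply/eqP => /(pendant_annihilator ev vx nc)[] /eqP; apply/negP.
  have nxc : x * c != z.
    by apply: contraNneq nvc => xc0; rewrite -xxv -mulgA xc0 mulg0.
  have vxc0 : v * (x * c) = z by rewrite mulgA vx0 mul0g.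
  case: (pendant_annihilator ev vx nxc vxc0) => // xcv.
  by case/eqP: nvc; rewrite -xxv -mulgA xcv mulC.
have xa := fix_x _ _ ab nax nbx.
have xb : x * b = x by apply: (fix_x b a); rewrite // adjacent_sym.
have [_ _ _ ab0] := adjacentP _ _ ab.
by case/eqP: nx; rewrite -xb -xa -mulgA ab0 mulg0.
Qed.

End ZeroDivisorSemigroup.

(** * The complement of the cut part *)

Theorem theorem2p1 (S : semigroupType) (z : S)
    (hS : zero_divisor_semigroup z)
    (x : S) (hx : vertices z x)
    (Tx : set S) (hTx : Tx `<=` [set: S] `\` [set z; x])
    (h1 : forall v, end_vertex z v -> adjacent z v x -> Tx v)
    (h2 : ([set: S] `\` (Tx `|` [set z; x])) !=set0 ->
          forall u v, Tx u -> ([set: S] `\` (Tx `|` [set z; x])) v ->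
          ~ adjacent z u v)
    (h3 : ([set: S] `\` (Tx `|` [set z; x])) !=set0 \/
          (has_cycle z /\ exists v, end_vertex z v /\ adjacent z x v)) :
  subsemigroup ([set: S] `\` Tx).
Proof.
have Tz : ~ Tx z by move=> /hTx[_]; apply; left.
have Tnx : ~ Tx x by move=> /hTx[_]; apply; right.
have rest w : ~ Tx w -> w != z -> w != x -> ([set: S] `\` (Tx `|` [set z; x])) w.
  by move=> Tw /eqP nw /eqP nwx; split=> // -[|[]].
have cut u v : Tx u -> adjacent z u v -> v != x -> Tx v.
  move=> Tu uv nvx; apply: contrapT => Tv.
  have nv : v != z by case/adjacentP: uv.
  by apply: h2 (rest v Tv nv nvx) uv => //; exists v; exact: rest.
have mul_notin b c : ~ Tx b -> b != z -> b != x -> ~ Tx (b * c)%g.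
  move=> Tb nb nbx.
  have [w [bw nwx]] : exists w, adjacent z b w /\ w != x.
    apply: contrapT => no_w.
    have only_x w : adjacent z b w -> w = x.
      by move=> bw; apply: contrapT => /eqP nwx; apply: no_w; exists w.
    have [w bw] := exists_neighbour hS nb hx nbx.
    have bx : adjacent z b x by rewrite -(only_x w bw).
    by apply: Tb; apply: h1 => //; apply/(end_vertex_unique_neighbour bx).
  exact: (cut_mul_notin hS Tz cut Tb nbx bw nwx).
have square_notin : ~ Tx (x * x)%g.
  have [[w [_ nTw]] | [cyc [v [ev xv]]]] := h3.
    apply: (cut_square_notin hS Tz cut (w := w)).
    - by apply/eqP => wz; apply: nTw; right; left.
    - by apply/eqP => wx; apply: nTw; right; right.
    - by move=> Tw; apply: nTw; left.
  have vx : adjacent z v x by rewrite adjacent_sym.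
  have nxx : (x * x)%g != v by exact: (pendant_square_neq hS ev vx cyc).
  have vxx0 : (v * (x * x))%g = z.
    by have [_ _ _ vx0] := adjacentP _ _ _ vx; rewrite mulgA vx0 (zds_mul0 hS).
  move=> Txx; have nz : (x * x)%g != z by apply/eqP => e; rewrite e in Txx.
  have [e|e] := pendant_annihilator ev vx nz vxx0; first by rewrite e eqxx in nxx.
  by rewrite e in Txx.
split; first by exists z.
move=> b c; rewrite !in_setE => -[_ Tb] [_ Tc]; split=> //.
have [->|nb] := eqVneq b z; first by rewrite (zds_mul0 hS).
have [ebx|nbx] := eqVneq b x; last exact: mul_notin.
have [->|nc] := eqVneq c z; first by rewrite (zds_mulC hS) (zds_mul0 hS).
have [->|ncx] := eqVneq c x; first by rewrite ebx.
by rewrite (zds_mulC hS); exact: mul_notin.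
Qed.
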